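(* Let $n\ge 1$ and let $N$ be a multiplicative, unitarily invariant, self-adjoint norm on $\mathbb{M}_n$. For every $X\in\mathbb{M}_n$, $$\omega_N(\operatorname{Re}(X))\le \omega_N(X).$$
   Context: $\mathbb{M}_n$ is the algebra of $n\times n$ complex matrices. A norm $N$ on $\mathbb{M}_n$ is multiplicative if $N(XY)\le N(X)N(Y)$ for all $X,Y\in\mathbb{M}_n$; unitarily invariant if $N(UXV)=N(X)$ for all $X\in\mathbb{M}_n$ and all unitary $U,V\in\mathbb{M}_n$; self-adjoint if $N(X^* )=N(X)$ for all $X$. Here $\operatorname{Re}(X)=\frac{X+X^*}{2}$, and the generalized numerical radius induced by $N$ is $\omega_N(X)=\sup_{\theta\in\mathbb{R}}N(\operatorname{Re}(e^{i\theta}X))$. *)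

(* Defs.v *)
From mathcomp Require Import all_boot all_order all_algebra.
From mathcomp Require Import all_classical all_reals all_analysis.
From mathcomp Require Import complex.

Set Implicit Arguments.
Unset Strict Implicit.
Unset Printing Implicit Defensive.

Import Order.TTheory GRing.Theory Num.Theory.

Local Open Scope classical_set_scope.
Local Open Scope ring_scope.
Local Open Scope complex_scope.
Local Open Scope sesquilinear_scope.

Section MatrixNorms.
Variables (R : realType) (n : nat).
Implicit Types (N : 'M[R[i]]_n -> R) (X Y U V : 'M[R[i]]_n).

Record is_mxnorm N : Prop := IsMxnorm {
  mxnorm_ge0 : forall X, 0 <= N X;
  mxnorm0_eq0 : forall X, N X = 0 -> X = 0;
  (* [ComplexField.Normc.normc c : R] is the modulus of [c]; [`|c|] would be in [R[i]]. *)
  mxnormZ : forall (c : R[i]) X, N (c *: X) = ComplexField.Normc.normc c * N X;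
  ler_mxnormD : forall X Y, N (X + Y) <= N X + N Y
}.

Definition mxnorm_multiplicative N : Prop :=
  forall X Y, N (X *m Y) <= N X * N Y.

Definition mxnorm_unitarily_invariant N : Prop :=
  forall X U V, U \is unitarymx -> V \is unitarymx -> N (U *m X *m V) = N X.

Definition mxnorm_self_adjoint N : Prop := forall X, N (X ^t*) = N X.

Definition mxRe X : 'M[R[i]]_n := 2^-1 *: (X + X ^t*).

Definition expi (t : R) : R[i] := cos t +i* sin t.

Definition num_radius N X : R :=
  sup [set N (mxRe (expi t *: X)) | t in [set: R]].

(* The real [sup] has a junk value on sets that are empty or unbounded above;
   this shows that it is the genuine supremum in [num_radius]. *)
Lemma num_radius_has_sup N X : is_mxnorm N -> mxnorm_self_adjoint N ->
  has_sup [set N (mxRe (expi t *: X)) | t in [set: R]].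
Proof.
move=> hN hsa; split; first by exists (N (mxRe (expi 0 *: X))), 0.
have normc_expi t : ComplexField.Normc.normc (expi t) = 1.
  by rewrite /= cos2Dsin2 sqrtr1.
set c := ComplexField.Normc.normc (2^-1 : R[i]).
have c0 : 0 <= c.
  by rewrite /c; case: (2^-1 : R[i]) => a b; exact: sqrtr_ge0.
exists (c * (N X + N X)) => _ [t _ <-].
rewrite /mxRe mxnormZ// -/c; apply: ler_wpM2l => //.
by apply: le_trans (ler_mxnormD hN _ _) _; rewrite hsa mxnormZ// normc_expi mul1r.
Qed.

End MatrixNorms.

(* Main.v *)
(* Since Re(X) is Hermitian, Re(e^{it} Re(X)) = cos t . Re(X), whose norm is at
   most N(Re(X)); and N(Re(X)) is the value at t = 0 in the supremum defining
   the radius of X. *)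
Require Import Defs.
From mathcomp Require Import all_boot all_order all_algebra.
From mathcomp Require Import all_classical all_reals all_analysis.
From mathcomp Require Import complex ring.

Import Order.TTheory GRing.Theory Num.Theory.

Local Open Scope ring_scope.
Local Open Scope complex_scope.

(** [mxRe X] equals its own conjugate transpose, so only the scalar is conjugated, and e^{it} +
    e^{-it} = 2 cos t factors out. *)
Lemma mxRe_expi_mxRe (R : realType) (n : nat) (t : R)
    (X : 'M[R[i]]_n) :
  mxRe (expi t *: mxRe X) = (cos t)%:C *: mxRe X.
Proof.
have conj2V : ((2^-1 : R[i])^*)%R = 2^-1 by rewrite fmorphV rmorph_nat.
have expiD : expi t + ((expi t)^*)%R = 2 * (cos t)%:C.
  by apply/eqP; rewrite eq_complex /=; apply/andP; split; apply/eqP; ring.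
apply/matrixP => i j; rewrite /mxRe !mxE !(rmorphM, rmorphD) /= conj2V conjCK.
(* Swapping the summands of the conjugated entry is the Hermitian symmetry of [mxRe X]. *)
by rewrite [X in _ + _ * (_ * X)]addrC -mulrDl expiD -mulrA mulKf//.
Qed.

Theorem proposition2p1 (R : realType) (n : nat) (hn : (1 <= n)%N)
    (N : 'M[R[i]]_n -> R)
    (hN : is_mxnorm N)
    (hmul : mxnorm_multiplicative N)
    (hinv : mxnorm_unitarily_invariant N)
    (hsa : mxnorm_self_adjoint N)
    (X : 'M[R[i]]_n) :
  num_radius N (mxRe X) <= num_radius N X.
Proof.
apply: ge_sup; first by exists (N (mxRe (expi 0 *: mxRe X))), 0.
move=> _ [t _ <-]; rewrite mxRe_expi_mxRe mxnormZ//.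
apply: (@le_trans _ _ (N (mxRe X))).
  (* The modulus of the scalar unfolds to sqrt(cos^2 t + 0^2) = |cos t|, which is at most 1. *)
  rewrite /= expr0n addr0 sqrtr_sqr ler_piMl ?mxnorm_ge0//.
  by rewrite ler_norml cos_geN1 cos_le1.
(* Boundedness of the set for [X] makes [sup] dominate its member at t = 0. *)
apply: (ub_le_sup (num_radius_has_sup X hN hsa).2).
by exists 0 => //; rewrite /expi cos0 sin0 scale1r.
Qed.
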